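(* Let $n\ge 2$, and let $W=(w_{ij})$ be an $n\times n$ matrix with zero diagonal and off-diagonal entries in $(0,1)$ such that the associated system of ML equations (given in the context) has a unique solution $(\hat a,\hat b)\in(0,\infty)^{2n}$. Let $$M=\max\left\{\max_{1\le i\le n}\left(-\frac{R_i}{n-1}\right),\ \max_{1\le i\le n}\left(-\frac{C_i}{n-1}\right)\right\},$$ and let $\varepsilon>0$ satisfy $\psi(2\varepsilon)-\psi(\varepsilon)=M$. Then, starting at $\theta^{(0)}=\varepsilon\mathbf{1}$, where $\mathbf 1\in\mathbb{R}^{2n}$ is the all-ones vector, the sequence defined by $\theta^{(it)}=f(\theta^{(it-1)})$, $it=1,2,\dots$, with $f$ the fixed-point map defined in the context, converges as $it\to\infty$ at a geometric rate to the unique solution $(\hat a,\hat b)$ of the ML equations.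
   Context: $\psi(x)=\Gamma'(x)/\Gamma(x)$, $x>0$, is the digamma function; it is a strictly increasing bijection $(0,\infty)\to\mathbb{R}$, with inverse $\psi^{-1}:\mathbb{R}\to(0,\infty)$. For $W$ as in the claim put $R_i=\sum_{j\ne i}\ln w_{ij}$ and $C_j=\sum_{i\ne j}\ln(1-w_{ij})$. The ML equations, in the unknown $\theta=(a,b)=(a_1,\dots,a_n,b_1,\dots,b_n)\in(0,\infty)^{2n}$, are $$\sum_{j\ne i}\psi(a_i+b_j)-(n-1)\psi(a_i)+R_i=0\quad(i=1,\dots,n),\qquad \sum_{i\ne j}\psi(a_i+b_j)-(n-1)\psi(b_j)+C_j=0\quad(j=1,\dots,n).$$ The map $f=(g_1,\dots,g_n,h_1,\dots,h_n):(0,\infty)^{2n}\to(0,\infty)^{2n}$ is defined by $$g_i(a,b)=\psi^{-1}\Big[\tfrac1{n-1}R_i+\tfrac1{n-1}\sum_{j\ne i}\psi(a_i+b_j)\Big],\qquad h_j(a,b)=\psi^{-1}\Big[\tfrac1{n-1}C_j+\tfrac1{n-1}\sum_{i\ne j}\psi(a_i+b_j)\Big].$$ The ML equations are equivalent to $\theta=f(\theta)$. Convergence of $\theta^{(it)}$ to $\hat\theta$ at a geometric rate means (at least geometric): there are constants $c>0$ and $q\in(0,1)$ with $\|\theta^{(it)}-\hat\theta\|\le c\,q^{it}$ for all $it$. *)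

(* Defs.v *)
From HB Require Import structures.
From mathcomp Require Import all_boot all_order all_algebra.
From mathcomp Require Import all_classical all_reals all_analysis.

Set Implicit Arguments.
Unset Strict Implicit.
Unset Printing Implicit Defensive.

Import Order.TTheory GRing.Theory Num.Theory.
Import numFieldNormedType.Exports.

Local Open Scope classical_set_scope.
Local Open Scope ring_scope.

(* Euler's integral; meaningful for x > 0 *)
Definition Gamma {R : realType} (x : R) : R :=
  \int[lebesgue_measure]_(t in `]0, +oo[) (t `^ (x - 1) * expR (- t)).

Definition digamma {R : realType} (x : R) : R := derive1 (@Gamma R) x / Gamma x.

(* Digamma is a bijection from (0, +oo) onto R; the partial inverse on
   (0, +oo) is therefore its inverse, with values in (0, +oo). *)
Definition digamma_inv {R : realType} : R -> R := pinv (`]0, +oo[ : set R) (@digamma R).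

Definition rowlog {R : realType} n (W : 'M[R]_n) (i : 'I_n) : R :=
  \sum_(j < n | j != i) ln (W i j).

Definition collog {R : realType} n (W : 'M[R]_n) (j : 'I_n) : R :=
  \sum_(i < n | i != j) ln (1 - W i j).

(* A vector theta of R^{2n} is the concatenation (a, b) of its left half
   a = lsubmx theta and its right half b = rsubmx theta. *)
Definition ML_solution {R : realType} n (W : 'M[R]_n) (theta : 'rV[R]_(n + n)) :
    Prop :=
  let a := fun i => lsubmx theta 0 i in
  let b := fun j => rsubmx theta 0 j in
  [/\ forall k, 0 < theta 0 k,
      forall i, \sum_(j < n | j != i) digamma (a i + b j)
                - n.-1%:R * digamma (a i) + rowlog W i = 0
    & forall j, \sum_(i < n | i != j) digamma (a i + b j)
                - n.-1%:R * digamma (b j) + collog W j = 0].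

Definition ML_map {R : realType} n (W : 'M[R]_n) (theta : 'rV[R]_(n + n)) :
    'rV[R]_(n + n) :=
  let a := fun i => lsubmx theta 0 i in
  let b := fun j => rsubmx theta 0 j in
  row_mx
    (\row_i digamma_inv (n.-1%:R^-1 * rowlog W i
       + n.-1%:R^-1 * \sum_(j < n | j != i) digamma (a i + b j)))
    (\row_j digamma_inv (n.-1%:R^-1 * collog W j
       + n.-1%:R^-1 * \sum_(i < n | i != j) digamma (a i + b j))).

(* The neutral element 0 does not affect the maxima for n >= 2 and off-diagonal
   entries in (0, 1): then every rowlog and collog is negative. *)
Definition ML_max {R : realType} n (W : 'M[R]_n) : R :=
  Num.max (\big[Num.max/0]_(i < n) - (rowlog W i / n.-1%:R))
          (\big[Num.max/0]_(i < n) - (collog W i / n.-1%:R)).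

(* The norm of a row vector is the sup norm; all norms on R^m being equivalent,
   another choice would only change the constant c. *)
Definition cvg_geometrically {R : realType} m (u : nat -> 'rV[R]_m)
    (l : 'rV[R]_m) : Prop :=
  exists c q : R, [/\ 0 < c, 0 < q < 1 & forall k, `|u k - l| <= c * q ^+ k].

(* Main.v *)
Require Import Defs.
From mathcomp Require Import all_boot all_order all_algebra.
From mathcomp Require Import all_classical all_reals all_analysis.
From mathcomp Require Import measurable_realfun.
From mathcomp Require Import zify ring lra.
Import Order.TTheory GRing.Theory Num.Theory.
Import numFieldNormedType.Exports.

(** The iteration is order preserving, and log-concavity of digamma makes it
contract towards the fixed point along the ray through the fixed point.

Put psi for the digamma function and write a coordinate of the ML map as
  psi (f(theta)_k) = r_k + mean over l of psi (theta_k + theta_l),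
where l ranges over the coordinates of the other block with a different
index. As psi is increasing, f is monotone. The decisive property of psi is
that s |-> psi (exp s) is strictly concave, that is, that x * psi'(x) is
strictly decreasing; equivalently, for 0 < t < 1 the difference
psi(x) - psi((1 - t) x) strictly decreases with x
([digamma_log_concave], with an explicit lower bound for the decrease).
Because theta_k + theta_l > theta_k, shrinking the fixed point hat by the
factor 1 - t lowers the right-hand side by less than it lowers psi(hat_k);
together with a Lipschitz bound for psi this gives, on any range
0 <= t <= t0 < 1, one q < 1 with f((1 - t) hat) >= (1 - q t) hat
([digamma_contraction], [mean_map_contraction]).

The choice of eps makes eps * 1 a lower bound of hat: at a smallest coordinate
mu of hat the equation gives psi(2 mu) - psi(mu) <= M, and psi(2x) - psi(x) is
strictly decreasing, again by log-concavity ([start_le_fixpoint]). Taking t0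
with (1 - t0) hat <= eps * 1, monotonicity gives by induction
  (1 - q^it t0) hat <= theta^(it) <= hat,
which is the geometric rate ([cvg_mean_map]).

What is needed about psi is derived from the integral defining Gamma as in the
Bohr-Mollerup theorem. Gamma satisfies Gamma(x + 1) = x Gamma(x)
([GammaS], integration by parts) and is log-convex ([lnGamma_convex], weighted
arithmetic-geometric inequality under the integral). A convex function f on the
positive half-line with f(x + 1) = f(x) + ln x is automatically differentiable,
its derivative being the limit of ln(x + N) - sum_(j < N) 1 / (x + j)
([is_derive_log_convex]); so differentiation under the integral is avoided, and
psi is this limit ([digammaE]). All inequalities for psi are proved for the
approximants at fixed N and passed to the limit. *)

Set Implicit Arguments.
Unset Strict Implicit.
Unset Printing Implicit Defensive.
Local Open Scope classical_set_scope.
Local Open Scope ring_scope.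

(** * The Gamma function: functional equation and log-convexity *)

Section Gamma_function.
Context {R : realType}.
Implicit Types x y t : R.
Notation mu := (@lebesgue_measure R).

Definition Gamma_integrand x t : R := t `^ (x - 1) * expR (- t).

(** The extended-real integral behind Gamma: the functional equation holds for it
without any integrability assumption, and finiteness is deduced from that. *)
Definition Gamma_integral x : \bar R :=
  (\int[mu]_(t in `]0%R, +oo[) (Gamma_integrand x t)%:E)%E.

Lemma GammaE x : Gamma x = fine (Gamma_integral x).
Proof. by []. Qed.

Lemma Gamma_integrand_ge0 x t : 0 <= Gamma_integrand x t.
Proof. by rewrite mulr_ge0 ?powR_ge0 ?expR_ge0. Qed.

Lemma measurable_Gamma_integrand x (D : set R) :
  measurable_fun D (EFin \o Gamma_integrand x).
Proof.
apply/measurable_EFinP; apply: measurable_funS (@subsetT _ D) _ => //.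
apply: measurable_funM; first exact: measurable_powR.
by apply: measurableT_comp => //; exact: measurable_oppr.
Qed.

(** The exponential series dominates its term of order m + 1. *)
Lemma powR_mulexpRN_le x (m : nat) t : x <= m%:R -> 1 <= t ->
  t `^ x * expR (- t) <= (m.+1)`!%:R / t.
Proof.
move=> xm t1; have t0 : 0 < t by apply: lt_le_trans t1.
have f0 : 0 < (m.+1)`!%:R :> R by rewrite ltr0n fact_gt0.
rewrite ler_pdivlMr// expRN mulrAC ler_pdivrMr ?expR_gt0//.
have tx : t `^ x <= t ^+ m by rewrite -powR_mulrn ?(ltW t0)//; exact: ler_powR.
apply: (@le_trans _ _ (t ^+ m.+1)); first by rewrite exprSr ler_wpM2r// ltW.
have := @expR_ge1Dxn R t m (ltW t0); rewrite -ler_pdivrMl// mulrC.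
by apply: le_trans; rewrite lerDr.
Qed.

Lemma is_derive_Nexp t : is_derive t 1 (fun s : R => - expR (- s)) (expR (- t)).
Proof. by apply: is_derive_eq; rewrite /GRing.scale/=; ring. Qed.

(** Integration by parts away from 0 and infinity, where the integrand may be
singular or the domain is not compact. *)
Lemma Gamma_integral_segment x (a b : R) : 0 < a -> a < b ->
  (\int[mu]_(t in `[a, b]) (Gamma_integrand (x + 1) t)%:E =
   (a `^ x * expR (- a) - b `^ x * expR (- b))%:E +
   x%:E * \int[mu]_(t in `[a, b]) (Gamma_integrand x t)%:E)%E.
Proof.
move=> a0 ab.
have pos t : t \in `[a, b] -> 0 < t.
  by rewrite in_itv/= => /andP[+ _]; apply: lt_le_trans.
have cpow y t : 0 < t -> {for t, continuous (fun s : R => s `^ y)}.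
  by move=> t0; apply/differentiable_continuous/derivable1_diffP/derivable_powR;
    rewrite in_itv/= andbT.
have cexp t : {for t, continuous (fun s : R => expR (- s))}.
  by apply: continuous_comp; [exact: opp_continuous|exact: continuous_expR].
have cNexp t : {for t, continuous (fun s : R => - expR (- s))}.
  by apply: continuousN; exact: cexp.
have b0 : 0 < b by apply: lt_trans ab.
have oo t : t \in `]a, b[ -> 0 < t.
  by rewrite in_itv/= => /andP[+ _]; apply: lt_trans.
have := @integration_by_parts R (fun s => s `^ x) (fun s => - expR (- s))
  (fun s => x * s `^ (x - 1)) (fun s => expR (- s)) a b ab.
have -> : (\int[mu]_(t in `[a, b]) (t `^ x * expR (- t))%:E =
    \int[mu]_(t in `[a, b]) (Gamma_integrand (x + 1) t)%:E)%E.
  by apply: eq_integral => t _; rewrite /Gamma_integrand addrK.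
have -> : (\int[mu]_(t in `[a, b]) (x * t `^ (x - 1) * - expR (- t))%:E =
    - x%:E * \int[mu]_(t in `[a, b]) (Gamma_integrand x t)%:E)%E.
  rewrite -EFinN -integralZl//=; last first.
    apply: continuous_compact_integrable; first exact: segment_compact.
    apply: continuous_in_subspaceT => t /set_mem/= /pos t0.
    have := continuousM (cpow (x - 1) t t0) (cexp t); exact.
  apply: eq_integral => t _; rewrite /Gamma_integrand -EFinM; congr EFin; ring.
move=> ->.
- by rewrite mulNe oppeK; congr (_%:E + _)%E; ring.
- apply: continuous_in_subspaceT => t /set_mem/= /pos t0.
  exact: (continuousM (@cst_continuous R R x t) (cpow (x - 1) t t0)).
- split.
  + by move=> t /oo t0; apply: derivable_powR; rewrite in_itv/= andbT.
  + by apply/cvg_at_right_filter; exact: cpow.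
  + by apply/cvg_at_left_filter; exact: cpow.
- move=> t /oo t0; apply: powR_derive1; by rewrite in_itv/= andbT.
- by apply: continuous_in_subspaceT => t _; exact: cexp.
- split.
  + by move=> t _; have [] := is_derive_Nexp t.
  + by apply/cvg_at_right_filter; exact: cNexp.
  + by apply/cvg_at_left_filter; exact: cNexp.
- by move=> t _; rewrite derive1E; have [_ ->] := is_derive_Nexp t.
Qed.

Definition exhaust (n : nat) : set R := `[n.+2%:R^-1, n.+2%:R]%classic.

Lemma nondecreasing_exhaust : nondecreasing_seq exhaust.
Proof.
apply/nondecreasing_seqP => n; rewrite subsetEset; apply: subset_itv => /=;
  by rewrite bnd_simp ?lef_pV2 ?posrE ?ltr0n// ler_nat.
Qed.

Lemma bigcup_exhaust : \bigcup_n exhaust n = `]0, +oo[%classic.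
Proof.
apply/seteqP; split => t /=.
  move=> [n _]; rewrite /exhaust/= !in_itv/= andbT => /andP[+ _].
  by apply: lt_le_trans; rewrite invr_gt0 ltr0n.
rewrite in_itv/= andbT => t0.
pose m := (Num.truncn t + Num.truncn t^-1)%N.
have bnd (s : R) k : 0 < s -> s <= (Num.truncn s + k).+2%:R.
  move=> s0; apply: (@le_trans _ _ (Num.truncn s).+1%:R).
    by apply/ltW; have /andP[] := truncn_itv (ltW s0).
  by rewrite ler_nat; lia.
exists m => //; rewrite /exhaust/= in_itv/= bnd// andbT.
by rewrite invf_ple ?posrE ?ltr0n// /m addnC bnd// invr_gt0.
Qed.

(** Monotone convergence: the integrand is nonnegative. *)
Lemma cvg_Gamma_integral_exhaust x :
  ((\int[mu]_(t in exhaust n) (Gamma_integrand x t)%:E)%E @[n --> \oo] -->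
    Gamma_integral x)%classic.
Proof.
rewrite /Gamma_integral -bigcup_exhaust.
apply: ge0_nondecreasing_set_cvg_integral => //.
- exact: nondecreasing_exhaust.
- by move=> i; exact: measurable_itv.
- by move=> i; exact: measurable_Gamma_integrand.
- by move=> i t _; rewrite lee_fin Gamma_integrand_ge0.
Qed.

Lemma Gamma_boundary_cvg0 x : 0 < x ->
  ((n.+2%:R^-1 `^ x * expR (- n.+2%:R^-1) - n.+2%:R `^ x * expR (- n.+2%:R) : R)
    @[n --> \oo] --> (0 : R))%classic.
Proof.
move=> x0.
have cvgV : ((n.+2%:R^-1 : R) @[n --> \oo] --> (0 : R))%classic.
  have := @cvg_harmonic R; rewrite -(cvg_shiftn 1) /harmonic/=.
  by under eq_fun do rewrite addn1.
rewrite -(subr0 (0 : R)); apply: cvgB.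
  have V0 (n : nat) : 0 < n.+2%:R^-1 :> R by rewrite invr_gt0 ltr0n.
  have powV := (cvg_at_rightP _ _ _).1 (powR_cvg0 x0) _ (conj V0 cvgV).
  have expV := cvg_comp _ _ (cvgN cvgV) (@continuous_expR R (- 0)).
  have := cvgM powV (expV _); rewrite mul0r; exact.
pose m := (Num.truncn x).+1.
have xm : x <= m%:R by apply/ltW; have /andP[] := truncn_itv (ltW x0).
apply: (@squeeze_cvgr _ _ _ _ (fun=> 0) (fun n => (m.+1)`!%:R / n.+2%:R)).
- near=> n; rewrite mulr_ge0 ?powR_ge0 ?expR_ge0//=.
  by rewrite powR_mulexpRN_le// ler1n.
- exact: cvg_cst.
- rewrite -[X in (_ --> X)%classic](mulr0 (m.+1)`!%:R).
  by apply: cvgM => //; exact: cvg_cst.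
Unshelve. all: by end_near. Qed.

(** The boundary terms of the integration by parts vanish at both ends. *)
Lemma Gamma_integralS x : 0 < x ->
  Gamma_integral (x + 1) = (x%:E * Gamma_integral x)%E.
Proof.
move=> x0.
have e n : (\int[mu]_(t in exhaust n) (Gamma_integrand (x + 1) t)%:E =
    (n.+2%:R^-1 `^ x * expR (- n.+2%:R^-1) - n.+2%:R `^ x * expR (- n.+2%:R))%:E
    + x%:E * \int[mu]_(t in exhaust n) (Gamma_integrand x t)%:E)%E.
  apply: Gamma_integral_segment; first by rewrite invr_gt0 ltr0n.
  apply: (@lt_trans _ _ 1); first by rewrite invf_lt1 ?ltr1n ?ltr0n.
  by rewrite ltr1n.
have h1 := @cvg_Gamma_integral_exhaust (x + 1).
have h2 : ((\int[mu]_(t in exhaust n) (Gamma_integrand (x + 1) t)%:E)%E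
    @[n --> \oo] --> (x%:E * Gamma_integral x)%E)%classic.
  rewrite -[X in (_ --> X)%classic]add0e.
  under eq_fun do rewrite e.
  apply: cvgeD; first by rewrite fin_num_adde_defr.
    by apply: cvg_EFin; [exact: nearW|exact: Gamma_boundary_cvg0].
  by apply: cvgeZl => //; exact: cvg_Gamma_integral_exhaust.
exact: (cvg_unique _ h1 h2).
Qed.

Lemma integral_expRN a : 0 <= a ->
  (\int[mu]_(t in `[a, +oo[) (expR (- t))%:E = (expR (- a))%:E)%E.
Proof.
move=> a0.
have cexp t : {for t, continuous (fun s : R => expR (- s))}.
  by apply: continuous_comp; [exact: opp_continuous|exact: continuous_expR].
rewrite (@ge0_continuous_FTC2y _ _ (fun t => - expR (- t)) _ 0).
- by rewrite sub0e EFinN oppeK.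
- by move=> t _; exact: expR_ge0.
- by apply: continuous_in_subspaceT => t _; exact: cexp.
- by rewrite -oppr0; apply: cvgN; exact: cvgr_expR.
- by move=> t _; have [] := is_derive_Nexp t.
- by apply: cvgN; apply/cvg_at_right_filter; exact: cexp.
- by move=> t _; rewrite derive1E; have [_ ->] := is_derive_Nexp t.
Qed.

Lemma Gamma_integral1 : Gamma_integral 1 = 1%E :> \bar R.
Proof.
rewrite /Gamma_integral integral_itv_obnd_cbnd; last first.
  exact: measurable_Gamma_integrand.
rewrite -[RHS](_ : (expR (- 0))%:E = _); last by rewrite oppr0 expR0.
rewrite -integral_expRN//.
by apply: eq_integral => t _; rewrite /Gamma_integrand subrr powRr0 mul1r.
Qed.

Lemma Gamma_integral_ge0 x : (0 <= Gamma_integral x)%E.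
Proof. by apply: integral_ge0 => t _; rewrite lee_fin Gamma_integrand_ge0. Qed.

Lemma Gamma_integral_nat_lty (n : nat) :
  (Gamma_integral (n.+1%:R : R) < +oo)%E.
Proof.
elim: n => [|n ih]; first by rewrite Gamma_integral1 ltry.
by rewrite -natr1 Gamma_integralS ?ltr0n// lte_mul_pinfty.
Qed.

(** By the functional equation it suffices to bound the value at x + 1, whose
integrand lies below the sum of those at 1 and at m + 1 for m >= x, according
to whether t is smaller or larger than 1. *)
Lemma Gamma_integral_lty x : 0 < x -> (Gamma_integral x < +oo)%E.
Proof.
move=> x0.
suff : (Gamma_integral (x + 1) < +oo)%E.
  rewrite Gamma_integralS//; have := Gamma_integral_ge0 x.
  by case: (Gamma_integral x) => // [r _ _|_]; rewrite ?ltry// gt0_muley.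
pose m := (Num.truncn x).+1.
have xm : x <= m%:R by apply/ltW; have /andP[] := truncn_itv (ltW x0).
apply: (@le_lt_trans _ _ (Gamma_integral 1 + Gamma_integral m.+1%:R)%E); last first.
  apply: lte_add_pinfty; last exact: (Gamma_integral_nat_lty m).
  by rewrite Gamma_integral1 ltry.
rewrite /Gamma_integral -ge0_integralD//=; last 4 first.
- by move=> t _; rewrite lee_fin Gamma_integrand_ge0.
- exact: measurable_Gamma_integrand.
- by move=> t _; rewrite lee_fin Gamma_integrand_ge0.
- exact: measurable_Gamma_integrand.
apply: ge0_le_integral => //=.
- by move=> t _; rewrite lee_fin Gamma_integrand_ge0.
- exact: measurable_Gamma_integrand.
- by apply: emeasurable_funD; exact: measurable_Gamma_integrand.
move=> t; rewrite in_itv/= andbT => t0.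
rewrite -EFinD lee_fin /Gamma_integrand -mulrDl ler_wpM2r ?expR_ge0//.
rewrite subrr powRr0 addrK -natr1 addrK.
have [t1|/ltW t1] := leP t 1.
  have e1 : 1 `^ x = 1 :> R by rewrite powR1.
  rewrite ler_wpDr ?powR_ge0// -[leRHS]e1.
  by rewrite ge0_ler_powR ?nnegrE// ltW.
by rewrite ler_wpDl// ler_powR.
Qed.

Lemma Gamma_integral_fin x : 0 < x -> Gamma_integral x = (Gamma x)%:E.
Proof.
move=> x0; rewrite GammaE fineK// ge0_fin_numE ?Gamma_integral_ge0//.
exact: Gamma_integral_lty.
Qed.

Lemma GammaS x : 0 < x -> Gamma (x + 1) = x * Gamma x.
Proof.
move=> x0; apply: EFin_inj.
by rewrite -Gamma_integral_fin ?addr_gt0// Gamma_integralS// Gamma_integral_fin.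
Qed.

(** At x + 1 the power is at least 1 on [1, +oo[, so the value there is at least
the integral of exp(- t) over [1, +oo[. *)
Lemma Gamma_gt0 x : 0 < x -> 0 < Gamma x.
Proof.
move=> x0; rewrite -(pmulr_rgt0 _ x0) -GammaS// -lte_fin -Gamma_integral_fin ?addr_gt0//.
apply: (@lt_le_trans _ _ (expR (- 1))%:E); first by rewrite lte_fin expR_gt0.
rewrite -integral_expRN//.
apply: (@le_trans _ _ (\int[mu]_(t in `[1%R, +oo[) (Gamma_integrand (x + 1) t)%:E)%E).
  apply: ge0_le_integral => //=.
  - apply/measurable_EFinP/measurable_funTS.
    by apply: measurableT_comp => //; exact: measurable_oppr.
  - exact: measurable_Gamma_integrand.
  move=> t; rewrite in_itv/= andbT => t1.
  rewrite lee_fin /Gamma_integrand addrK ler_peMl ?expR_ge0//.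
  by rewrite -[leLHS](powRr0 t) ler_powR// ltW.
apply: ge0_subset_integral => //=.
- exact: measurable_Gamma_integrand.
- by move=> t _; rewrite lee_fin Gamma_integrand_ge0.
- by apply: subset_itvr; rewrite bnd_simp.
Qed.

Lemma expR_convex (s p q : R) : 0 <= s <= 1 ->
  expR (s * p + (1 - s) * q) <= s * expR p + (1 - s) * expR q.
Proof.
move=> /andP[s0 s1]; set m := s * p + _.
(* the graph of exp lies above its tangent at the weighted mean m *)
have tangent r : expR m * (1 + (r - m)) <= expR r.
  have -> : expR r = expR m * expR (r - m) by rewrite -expRD subrKC.
  by rewrite ler_wpM2l ?expR_ge0// expR_ge1Dx.
have : s * (expR m * (1 + (p - m))) + (1 - s) * (expR m * (1 + (q - m))) <=
   s * expR p + (1 - s) * expR q.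
  by apply: lerD; apply: ler_wpM2l; rewrite ?subr_ge0.
apply: le_trans; rewrite le_eqVlt; apply/orP; left; apply/eqP; rewrite /m; ring.
Qed.

(** Convexity of exp applied pointwise to the logarithms of the integrands,
normalised to have integral 1. *)
Lemma Gamma_integral_log_convex (s x y gx gy : R) : 0 <= s <= 1 ->
  0 < gx -> 0 < gy ->
  Gamma_integral x = gx%:E -> Gamma_integral y = gy%:E ->
  (Gamma_integral (s * x + (1 - s) * y) <=
    (expR (s * ln gx + (1 - s) * ln gy))%:E)%E.
Proof.
move=> s01 gx0 gy0 Ex Ey; have /andP[s0 s1] := s01.
set z := s * x + (1 - s) * y; set C := s * ln gx + (1 - s) * ln gy.
pose cx := expR C * s / gx; pose cy := expR C * (1 - s) / gy.
have cx0 : 0 <= cx by rewrite divr_ge0 ?mulr_ge0 ?expR_ge0// ltW.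
have cy0 : 0 <= cy by rewrite divr_ge0 ?mulr_ge0 ?expR_ge0 ?subr_ge0// ltW.
have -> : (expR C)%:E = (cx%:E * Gamma_integral x + cy%:E * Gamma_integral y)%E.
  rewrite Ex Ey -!EFinM -EFinD /cx /cy; congr EFin; field.
  by rewrite !gt_eqF.
have mZ (c w : R) : measurable_fun (`]0%R, +oo[%classic : set R)
    (fun t => c%:E * (Gamma_integrand w t)%:E)%E.
  by apply: measurable_funeM; exact: measurable_Gamma_integrand.
have Z0 (c w t : R) : 0 <= c -> (0 <= c%:E * (Gamma_integrand w t)%:E)%E.
  by move=> c0; rewrite mule_ge0// lee_fin// Gamma_integrand_ge0.
have ZE (c w : R) : 0 <= c -> (c%:E * Gamma_integral w =
    \int[mu]_(t in `]0%R, +oo[) (c%:E * (Gamma_integrand w t)%:E))%E.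
  move=> c0; rewrite ge0_integralZl_EFin//.
  - by move=> t _; rewrite lee_fin Gamma_integrand_ge0.
  - exact: measurable_Gamma_integrand.
rewrite !ZE// -ge0_integralD//;
  [|by [exact: mZ|move=> t _; exact: Z0]..].
apply: ge0_le_integral => //.
- by move=> t _; rewrite lee_fin Gamma_integrand_ge0.
- exact: measurable_Gamma_integrand.
- by apply: emeasurable_funD; exact: mZ.
move=> t /=; rewrite in_itv/= andbT => t0.
rewrite -!EFinM -EFinD lee_fin.
have E w : Gamma_integrand w t = expR ((w - 1) * ln t - t).
  by rewrite /Gamma_integrand /powR gt_eqF// expRD.
pose p := (x - 1) * ln t - t - ln gx.
pose q := (y - 1) * ln t - t - ln gy.
have -> : Gamma_integrand z t = expR C * expR (s * p + (1 - s) * q).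
  by rewrite E -expRD; congr expR; rewrite /z /C /p /q; ring.
have Ep : expR p = Gamma_integrand x t / gx.
  by rewrite /p expRB lnK ?posrE// E.
have Eq : expR q = Gamma_integrand y t / gy.
  by rewrite /q expRB lnK ?posrE// E.
have -> : cx * Gamma_integrand x t + cy * Gamma_integrand y t =
    expR C * (s * expR p + (1 - s) * expR q).
  by rewrite Ep Eq /cx /cy; field; rewrite !gt_eqF.
by rewrite ler_wpM2l ?expR_ge0// expR_convex.
Qed.

Lemma lnGamma_convex (s x y : R) : 0 <= s <= 1 -> 0 < x -> 0 < y ->
  ln (Gamma (s * x + (1 - s) * y)) <= s * ln (Gamma x) + (1 - s) * ln (Gamma y).
Proof.
move=> s01 x0 y0.
set z := s * x + (1 - s) * y.
have z0 : 0 < z.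
  have /andP[s0 s1] := s01.
  rewrite /z; have [->|sn0] := eqVneq s 0; first by rewrite mul0r add0r subr0 mul1r.
  by rewrite ltr_wpDr ?mulr_ge0 ?subr_ge0 ?(ltW y0)// mulr_gt0// lt0r sn0.
rewrite -ler_expR lnK; last by rewrite posrE; exact: Gamma_gt0.
rewrite -lee_fin -(Gamma_integral_fin z0).
apply: Gamma_integral_log_convex (s01) _ _ _ _.
- exact: Gamma_gt0.
- exact: Gamma_gt0.
- exact: Gamma_integral_fin.
- exact: Gamma_integral_fin.
Qed.
End Gamma_function.

(** * Differentiability of ln Gamma, and digamma as a limit *)

Section digamma_approximation.
Context {R : realType}.
Implicit Types x y h : R.

(** For ln Gamma the telescoped functional equation is
ln Gamma x = ln Gamma (x + N) - sum_(j < N) ln (x + j); the approximant is the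
formal derivative of the right-hand side, the derivative of ln Gamma at
x + N being replaced by ln (x + N). *)
Definition digamma_approx (N : nat) x : R :=
  ln (x + N%:R) - \sum_(j < N) (x + j%:R)^-1.

Lemma addr_natr_gt0 x (j : nat) : 0 < x -> 0 < x + j%:R.
Proof. by move=> x0; rewrite ltr_wpDr. Qed.

Lemma ln_succ_bounds x : 0 < x ->
  (x + 1)^-1 <= ln (x + 1) - ln x <= x^-1.
Proof.
move=> x0; have x10 : 0 < x + 1 by rewrite addr_gt0.
rewrite -ln_div ?posrE//; apply/andP; split; last first.
  have -> : (x + 1) / x = 1 + x^-1 by field; rewrite gt_eqF.
  by rewrite le_ln1Dx// (lt_trans _ (_ : 0 < _)) ?invr_gt0// ltrN10.
rewrite -[(x + 1) / x]invrK lnV ?posrE ?invr_gt0 ?divr_gt0//.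
rewrite lerNr invf_div.
have -> : x / (x + 1) = 1 + (- (x + 1)^-1) by field; rewrite gt_eqF.
by rewrite le_ln1Dx// ltrN2 invf_lt1// ltrDr.
Qed.

(** The approximants decrease, while becoming increasing after subtraction of
1 / (x + N): the two monotone sequences enclose the limit. *)
Lemma digamma_approxS N x : 0 < x ->
  digamma_approx N x - (x + N%:R)^-1 <=
    digamma_approx N.+1 x - (x + N.+1%:R)^-1 /\
  digamma_approx N.+1 x <= digamma_approx N x.
Proof.
move=> x0; rewrite /digamma_approx big_ord_recr/= -natr1 addrA.
have /ln_succ_bounds := addr_natr_gt0 N x0; lra.
Qed.

Lemma digamma_approx_nonincreasing x : 0 < x ->
  nonincreasing_seq (digamma_approx ^~ x).
Proof.
by move=> x0; apply/nonincreasing_seqP => N; have [] := digamma_approxS N x0.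
Qed.

Lemma digamma_approx_lower_nondecreasing x : 0 < x ->
  nondecreasing_seq (fun N => digamma_approx N x - (x + N%:R)^-1).
Proof.
by move=> x0; apply/nondecreasing_seqP => N; have [] := digamma_approxS N x0.
Qed.

Lemma digamma_approx_cvg x : 0 < x -> cvgn (digamma_approx ^~ x).
Proof.
move=> x0; apply: nonincreasing_is_cvgn; first exact: digamma_approx_nonincreasing.
exists (digamma_approx 0 x - (x + 0%:R)^-1) => _ [N _ <-].
apply: le_trans (digamma_approx_lower_nondecreasing x0 (leq0n N)) _.
by rewrite gerBl invr_ge0 ltW// addr_natr_gt0.
Qed.

Definition digamma_lim x : R := limn (digamma_approx ^~ x).

Lemma digamma_lim_bounds N x : 0 < x ->
  digamma_approx N x - (x + N%:R)^-1 <= digamma_lim x <= digamma_approx N x.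
Proof.
move=> x0; apply/andP; split; last first.
  apply: nonincreasing_cvgn_ge; first exact: digamma_approx_nonincreasing.
  exact: digamma_approx_cvg.
apply: limr_ge; first exact: digamma_approx_cvg.
near=> M.
apply: (@le_trans _ _ (digamma_approx M x - (x + M%:R)^-1)).
  apply: (digamma_approx_lower_nondecreasing x0).
  by near: M; exact: nbhs_infty_ge.
by rewrite gerBl invr_ge0 ltW// addr_natr_gt0.
Unshelve. all: by end_near. Qed.

Lemma is_derive_bigsum (N : nat) (f : 'I_N -> R -> R) (d : 'I_N -> R) x :
  (forall j, is_derive x 1 (f j) (d j)) ->
  is_derive x 1 (fun y => \sum_(j < N) f j y) (\sum_(j < N) d j).
Proof.
move=> H; have := is_derive_sum H.
by congr is_derive; apply/funext => y; rewrite fct_sumE.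
Qed.

Lemma is_derive_slope (f : R -> R) x d : is_derive x 1 f d ->
  (h^-1 * (f (h + x) - f x) @[h --> 0^'] --> d)%classic.
Proof.
move=> [df <-]; move: df; rewrite /derivable /derive => df.
by under eq_fun do rewrite -[X in f (X + x)]mulr1.
Qed.

Lemma slope_is_derive (f : R -> R) x d :
  (h^-1 * (f (h + x) - f x) @[h --> 0^'] --> d)%classic -> is_derive x 1 f d.
Proof.
under eq_fun do rewrite -[X in f (X + x)]mulr1.
move=> H; apply: DeriveDef; first exact: cvgP H.
exact: cvg_lim H.
Qed.

(** The function f stands for ln Gamma; its convexity and its functional
equation are all that is used. *)
Context (f : R -> R)
  (f_convex : forall s x y : R, 0 <= s <= 1 -> 0 < x -> 0 < y ->
    f (s * x + (1 - s) * y) <= s * f x + (1 - s) * f y)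
  (fS : forall x, 0 < x -> f (x + 1) = f x + ln x).

(** Convexity compares the chord between y and y + h with the two unit chords
around y, whose slopes are ln (y - 1) and ln y by the functional equation. For
either sign of h one bound comes from y + h lying between y and a neighbour
y - 1 or y + 1, the other from y lying between y + h and the opposite
neighbour. *)
Lemma slope_bounds y h : 1 < y -> h != 0 -> `|h| < 1 ->
  ln (y - 1) <= h^-1 * (f (h + y) - f y) <= ln y.
Proof.
move=> y1 h0 h1.
have y0 : 0 < y by lra.
have fy1 : f y = f (y - 1) + ln (y - 1).
  by rewrite -fS ?subr_gt0// subrK.
have fy2 := fS y0.
move: h0 h1; case: (ltgtP h 0) => // hs _ h1.
- pose k := - h; have [k0 k1] : 0 < k /\ k < 1.
    by move: h1; rewrite ltr0_norm// /k; lra.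
  have hk : h = - k by rewrite /k opprK.
  rewrite hk invrN mulNr -mulrN opprB ler_pdivlMl// ler_pdivrMl//.
  have k01 : 0 <= k <= 1 by lra.
  have A := @f_convex k (y - 1) y k01 (ltac:(lra)) y0.
  have kk : 0 <= k / (1 + k) <= 1.
    by rewrite divr_ge0 ?ler_pdivrMr/=; lra.
  have B := @f_convex (k / (1 + k)) (y + 1) (- k + y) kk (ltac:(lra)) (ltac:(lra)).
  have eA : k * (y - 1) + (1 - k) * y = - k + y by ring.
  have eB : k / (1 + k) * (y + 1) + (1 - k / (1 + k)) * (- k + y) = y.
    by field; rewrite gt_eqF//; lra.
  rewrite eA in A; rewrite eB in B.
  have B' : (1 + k) * f y <= k * f (y + 1) + f (- k + y).
    rewrite -ler_pdivlMl; last lra.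
    apply: le_trans B _; rewrite le_eqVlt; apply/orP; left; apply/eqP.
    by field; rewrite gt_eqF//; lra.
  apply/andP; split; nra.
- have [k0 k1] : 0 < h /\ h < 1 by move: h1; rewrite gtr0_norm//.
  rewrite ler_pdivlMl// ler_pdivrMl//.
  have k01 : 0 <= h <= 1 by lra.
  have A := @f_convex h (y + 1) y k01 (ltac:(lra)) y0.
  have kk : 0 <= h / (1 + h) <= 1.
    by rewrite divr_ge0 ?ler_pdivrMr/=; lra.
  have B := @f_convex (h / (1 + h)) (y - 1) (h + y) kk (ltac:(lra)) (ltac:(lra)).
  have eA : h * (y + 1) + (1 - h) * y = h + y by ring.
  have eB : h / (1 + h) * (y - 1) + (1 - h / (1 + h)) * (h + y) = y.
    by field; rewrite gt_eqF//; lra.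
  rewrite eA in A; rewrite eB in B.
  have B' : (1 + h) * f y <= h * f (y - 1) + f (h + y).
    rewrite -ler_pdivlMl; last lra.
    apply: le_trans B _; rewrite le_eqVlt; apply/orP; left; apply/eqP.
    by field; rewrite gt_eqF//; lra.
  apply/andP; split; nra.
Qed.

Lemma iter_fS N x : 0 < x -> f (x + N%:R) = f x + \sum_(j < N) ln (x + j%:R).
Proof.
move=> x0; elim: N => [|N ih]; first by rewrite big_ord0 !addr0.
by rewrite -natr1 addrA fS ?addr_natr_gt0// ih big_ord_recr/= addrA.
Qed.

(** The slopes at x are those at x + N minus those of a finite sum of logarithms.
The former are known up to 1 / (x + N - 1) by [slope_bounds], uniformly in the
increment; the latter converge to the finite sum of derivatives. So the slopes
at x converge to the limit of the approximants. *)
Lemma is_derive_log_convex x : 0 < x -> is_derive x 1 f (digamma_lim x).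
Proof.
move=> x0; apply: slope_is_derive; apply/cvgrPdist_le => e e0.
(* N is so large that both error terms in N are at most e / 4 *)
pose N := (Num.truncn (4 / e)).+2.
have Ne : (x + N%:R - 1)^-1 <= e / 4 /\ (x + N%:R)^-1 <= e / 4.
  have N4 : 4 / e <= N.-1%:R.
    by apply/ltW; have /andP[] := truncn_itv (ltW (divr_gt0 (ltr0n _ 4) e0)).
  have e4 : 0 < 4 / e by rewrite divr_gt0.
  have NE : N%:R = N.-1%:R + 1 :> R by rewrite natr1.
  by split; rewrite -[leRHS]invrK invf_div lef_pV2 ?posrE//; lra.
have dL : is_derive x 1 (fun y => \sum_(j < N) ln (y + j%:R))
    (\sum_(j < N) (x + j%:R)^-1).
  apply: is_derive_bigsum => j.
  have := @is_derive1_comp R (@ln R) (fun y => y + j%:R) x (x + j%:R)^-1 1.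
  rewrite mulr1; apply.
    by apply: is_derive1_ln; exact: addr_natr_gt0.
  by apply: is_derive_eq; rewrite addr0.
have /is_derive_slope/cvgrPdist_le/(_ (e / 2) (divr_gt0 e0 (ltr0n _ 2))) sL := dL.
near=> h.
have h1 : `|h| < 1 by near: h; apply: dnbhs0_lt.
have h0 : h != 0 by near: h; exact: nbhs_dnbhs_neq.
have hx : 0 < h + x.
  have : `|h| < x by near: h; apply: dnbhs0_lt.
  by rewrite ltr_norml => /andP[? _]; lra.
have xN1 : 1 < x + N%:R.
  by rewrite /N -natr1; have : 0 <= (Num.truncn (4 / e)).+1%:R :> R by []; lra.
have SN := slope_bounds xN1 h0 h1.
have [dl1 dl2] := andP (digamma_lim_bounds N x0).
have : `|\sum_(j < N) (x + j%:R)^-1 -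
    h^-1 * (\sum_(j < N) ln (h + x + j%:R) - \sum_(j < N) ln (x + j%:R))| <= e / 2.
  by near: h.
have fE : h^-1 * (f (h + x) - f x) = h^-1 * (f (h + (x + N%:R)) - f (x + N%:R)) -
    h^-1 * (\sum_(j < N) ln (h + x + j%:R) - \sum_(j < N) ln (x + j%:R)).
  by rewrite addrA !iter_fS//; ring.
have xN0 : 0 < x + N%:R - 1 by lra.
have /andP[_] := ln_succ_bounds xN0; rewrite subrK => lnb.
rewrite fE; move: SN dl1 dl2; rewrite /digamma_approx.
set S1 := h^-1 * (f _ - _); set S2 := h^-1 * _.
rewrite !ler_norml; move: lnb Ne => + [].
set a := ln (x + N%:R); set b := ln _.
move=> lnb n1 n2 /andP[s1 s2] l1 l2 /andP[e1 e2]; apply/andP; split; lra.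
Unshelve. all: by end_near. Qed.

End digamma_approximation.

Section digamma.
Context {R : realType}.
Implicit Types x y : R.

Lemma lnGammaS x : 0 < x -> ln (Gamma (x + 1)) = ln (Gamma x) + ln x.
Proof.
move=> x0; rewrite (GammaS x0) lnM; first exact: addrC.
  by rewrite posrE.
by rewrite posrE; exact: Gamma_gt0.
Qed.

Lemma digammaE x : 0 < x -> digamma x = digamma_lim x.
Proof.
move=> x0.
have Gx0 := Gamma_gt0 x0.
have dlnG : is_derive x 1 (fun y => ln (Gamma y)) (digamma_lim x).
  apply: is_derive_log_convex => //.
    by move=> s y z; exact: lnGamma_convex.
  exact: lnGammaS.
have dG : is_derive x 1 Gamma (Gamma x * digamma_lim x).
  have dexp : is_derive (ln (Gamma x)) 1 expR (Gamma x).
    by rewrite -[X in is_derive _ _ _ X](lnK Gx0); exact: is_derive_expR.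
  have dc := @is_derive1_comp R (@expR R) (fun y => ln (Gamma y)) x _ _ dexp dlnG.
  apply: (@near_eq_is_derive R R R _ (@Gamma R) x 1 _ _ dc).
  near=> y; rewrite /= lnK// posrE; apply: Gamma_gt0.
  by near: y; exact: lt_nbhsr.
by rewrite /digamma derive1E (@derive_val _ _ _ _ _ _ _ dG) mulrC mulKf// gt_eqF.
Unshelve. all: by end_near. Qed.

End digamma.

(** * Monotonicity, Lipschitz bound and log-concavity of digamma *)

Section digamma_estimates.
Context {R : realType}.
Implicit Types x y a c t : R.

Lemma digamma_approx_to_digamma x : 0 < x ->
  (digamma_approx N x @[N --> \oo] --> digamma x)%classic.
Proof. by move=> x0; rewrite digammaE//; exact: digamma_approx_cvg. Qed.

Lemma digamma_ln_bounds x : 0 < x -> ln x - x^-1 <= digamma x <= ln x.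
Proof.
move=> x0; rewrite digammaE//; have := digamma_lim_bounds 0 x0.
by rewrite /digamma_approx big_ord0 subr0 addr0.
Qed.

Lemma ln_lipschitz x y : 0 < x -> x <= y -> ln y - ln x <= (y - x) / x.
Proof.
move=> x0 xy; have y0 : 0 < y by lra.
rewrite -ln_div ?posrE//.
have -> : y / x = 1 + (y - x) / x by field; rewrite gt_eqF.
by rewrite le_ln1Dx// (lt_le_trans (ltrN10 _))// divr_ge0 ?subr_ge0 // ltW.
Qed.

(** The left-hand side decreases with N, as 1 / (m + 1)^2 is smaller than
1 / m - 1 / (m + 1). *)
Lemma sum_inv_sq_le N x : 0 < x ->
  \sum_(j < N.+1) (x + j%:R)^-2 + (x + N%:R)^-1 <= x^-1 + x^-2.
Proof.
move=> x0; elim: N => [|N ih].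
  by rewrite big_ord_recr big_ord0/= add0r addr0 addrC.
rewrite big_ord_recr/=; apply: le_trans ih; rewrite -addrA lerD2l.
have m0 := addr_natr_gt0 N x0.
rewrite -natr1 addrA; set m := x + N%:R in m0 *.
rewrite -subr_ge0.
have -> : m^-1 - ((m + 1) ^- 2 + (m + 1)^-1) = (m * (m + 1) ^+ 2)^-1.
  by field; rewrite !gt_eqF//; lra.
by rewrite invr_ge0 mulr_ge0 ?sqr_ge0// ltW.
Qed.

Lemma digamma_approx_lipschitz N x y : 0 < x -> x <= y ->
  digamma_approx N.+1 y - digamma_approx N.+1 x <= (y - x) * (x^-1 + x^-2).
Proof.
move=> x0 xy; have y0 : 0 < y by lra.
rewrite /digamma_approx.
have lnle : ln (y + N.+1%:R) - ln (x + N.+1%:R) <= (y - x) * (x + N%:R)^-1.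
  apply: le_trans (ln_lipschitz _ _) _; first exact: addr_natr_gt0.
    by rewrite lerD2r.
  rewrite opprD addrACA subrr addr0 ler_wpM2l ?subr_ge0//.
  by rewrite lef_pV2 ?posrE ?addr_natr_gt0// lerD2l ler_nat.
have sumle : \sum_(j < N.+1) (x + j%:R)^-1 - \sum_(j < N.+1) (y + j%:R)^-1 <=
    (y - x) * \sum_(j < N.+1) (x + j%:R)^-2.
  rewrite -sumrB mulr_sumr; apply: ler_sum => j _.
  have xj := addr_natr_gt0 j x0; have yj := addr_natr_gt0 j y0.
  have -> : (x + j%:R)^-1 - (y + j%:R)^-1 =
      (y - x) * ((x + j%:R)^-1 * (y + j%:R)^-1).
    by field; rewrite !gt_eqF.
  rewrite ler_wpM2l ?subr_ge0// expr2 invfM ler_wpM2l ?invr_ge0 ?(ltW xj)//.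
  by rewrite lef_pV2 ?posrE// lerD2r.
have := ler_wpM2l (_ : 0 <= y - x) (sum_inv_sq_le N x0).
by rewrite subr_ge0 mulrDr => /(_ xy); lra.
Qed.

(** Only the term of index 0 of the sum is kept, all others having the right sign;
it already yields a strictly positive increment independent of N. *)
Lemma digamma_approx_ge N x y : 0 < x -> x <= y ->
  x^-1 - y^-1 <= digamma_approx N.+1 y - digamma_approx N.+1 x.
Proof.
move=> x0 xy; have y0 : 0 < y by lra.
rewrite /digamma_approx !big_ord_recl/= !addr0.
have lnle : ln (x + N.+1%:R) <= ln (y + N.+1%:R).
  by rewrite ler_ln ?posrE ?addr_natr_gt0// lerD2r.
have sumle : \sum_(i < N) (y + (bump 0 i)%:R)^-1 <= \sum_(i < N) (x + (bump 0 i)%:R)^-1.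
  apply: ler_sum => i _.
  by rewrite lef_pV2 ?posrE ?addr_natr_gt0// lerD2r.
lra.
Qed.

(** The approximant of index 0 is left out because the inequalities below need at
least one term in the sum. *)
Lemma le_from_digamma_approx (u : nat -> R) l b :
  (u N @[N --> \oo] --> l)%classic -> (forall N, u N.+1 <= b) -> l <= b.
Proof.
move=> ul ub; apply: (cvgr_to_le ul); near=> N.
have N0 : (0 < N)%N by near: N; exact: nbhs_infty_gt.
by rewrite -(prednK N0); exact: ub.
Unshelve. all: by end_near. Qed.

Lemma digamma_lipschitz x y : 0 < x -> x <= y ->
  digamma y - digamma x <= (y - x) * (x^-1 + x^-2).
Proof.
move=> x0 xy; have y0 : 0 < y by lra.
apply: (@le_from_digamma_approx (fun N => digamma_approx N y - digamma_approx N x)).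
  by apply: cvgB; exact: digamma_approx_to_digamma.
by move=> N; exact: digamma_approx_lipschitz.
Qed.

Lemma digamma_ge x y : 0 < x -> x <= y -> x^-1 - y^-1 <= digamma y - digamma x.
Proof.
move=> x0 xy; have y0 : 0 < y by lra.
rewrite -lerN2.
apply: (@le_from_digamma_approx (fun N => - (digamma_approx N y - digamma_approx N x))).
  by apply: cvgN; apply: cvgB; exact: digamma_approx_to_digamma.
by move=> N; rewrite lerN2; exact: digamma_approx_ge.
Qed.

Lemma digamma_mono x y : 0 < x -> 0 < y -> (digamma x <= digamma y) = (x <= y).
Proof.
move=> x0 y0; have [xy|yx] := leP x y.
  rewrite -subr_ge0; apply: le_trans (digamma_ge x0 xy).
  by rewrite subr_ge0 lef_pV2.
apply/negbTE; rewrite -ltNge.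
rewrite -subr_gt0; apply: lt_le_trans (digamma_ge y0 (ltW yx)).
by rewrite subr_gt0 ltf_pV2.
Qed.

(** The derivative of the approximant, an approximation of the trigamma
function. *)
Definition digamma_approx_der N x := (x + N%:R)^-1 + \sum_(j < N) (x + j%:R)^-2.

Lemma is_derive_inv_shift c x : 0 < x + c ->
  is_derive x 1 (fun y => (y + c)^-1) (- (x + c)^-2).
Proof.
move=> xc.
have dc : is_derive x 1 (fun y : R => y + c) 1 by apply: is_derive_eq; rewrite addr0.
have xc0 : x + c != 0 by rewrite gt_eqF.
have := @is_deriveV R (fun y => y + c) x 1 1 xc0 dc => dV.
by apply: (is_derive_eq dV); rewrite /GRing.scale/= mulr1.
Qed.

Lemma is_derive_digamma_approx N x : 0 < x ->
  is_derive x 1 (digamma_approx N) (digamma_approx_der N x).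
Proof.
move=> x0.
have dln : is_derive x 1 (fun y => ln (y + N%:R)) (x + N%:R)^-1.
  have := @is_derive1_comp R (@ln R) (fun y => y + N%:R) x (x + N%:R)^-1 1.
  rewrite mulr1; apply.
    by apply: is_derive1_ln; exact: addr_natr_gt0.
  by apply: is_derive_eq; rewrite addr0.
have dS : is_derive x 1 (fun y => \sum_(j < N) (y + j%:R)^-1)
    (\sum_(j < N) - (x + j%:R)^-2).
  by apply: is_derive_bigsum => j; apply: is_derive_inv_shift; exact: addr_natr_gt0.
have dB := is_deriveB dln dS; apply: (is_derive_eq dB).
by rewrite /digamma_approx_der sumrN opprK.
Qed.

(** An upper bound for the derivative of x * psi'(x) at the approximants.
Termwise, (j - x) / (x + j)^3 = 2 j / (x + j)^3 - 1 / (x + j)^2 has no constant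
sign. The term added to the sum dominates the contribution
(N + 1) / (x + N + 1)^2 of the logarithm and makes the left-hand side
decreasing in N, since
2 / m^3 <= 1 / ((m - 1) m) - 1 / (m (m + 1)); for N = 0 equality holds. *)
Lemma log_concavity_bound N x : 0 < x ->
  \sum_(j < N.+1) (j%:R - x) / (x + j%:R) ^+ 3 +
    N.+1%:R / ((x + N%:R) * (x + N.+1%:R)) <= - (x ^+ 2 * (x + 1))^-1.
Proof.
move=> x0; elim: N => [|N ih].
  rewrite big_ord_recr big_ord0/= !addr0 !add0r le_eqVlt; apply/orP; left.
  by apply/eqP; field; rewrite !gt_eqF//; lra.
apply: le_trans ih; rewrite big_ord_recr/= -addrA lerD2l.
have n0 : 0 < N.+1%:R :> R by [].
have m0 := addr_natr_gt0 N x0.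
have -> : x + N.+2%:R = x + N.+1%:R + 1 by rewrite -[N.+2%:R]natr1 addrA.
have -> : N.+2%:R = N.+1%:R + 1 :> R by rewrite natr1.
have xN : x + N%:R = x + N.+1%:R - 1 by rewrite -natr1; ring.
rewrite xN in m0 *.
set n : R := N.+1%:R in n0 m0 *.
have -> : n - x = 2 * n - (x + n) by ring.
set m := x + n in m0 *.
rewrite -subr_ge0.
have -> : n / ((m - 1) * m) - ((2 * n - m) / m ^+ 3 + (n + 1) / (m * (m + 1))) =
   (2 * n / (m ^+ 3 * (m - 1) * (m + 1)) + (m ^+ 2 * (m + 1))^-1).
  by field; rewrite !gt_eqF//; lra.
have m1 : 0 < m by lra.
by rewrite addr_ge0// ?invr_ge0 ?divr_ge0 ?mulr_ge0// ?exprn_ge0//; lra.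
Qed.

(** The function y * psi_N'(y) is the derivative of psi_N (exp s) at s = ln y. *)
Lemma is_derive_log_derivative N x : 0 < x ->
  is_derive x 1 (fun y => y * digamma_approx_der N.+1 y)
    (N.+1%:R / (x + N.+1%:R) ^+ 2 +
      \sum_(j < N.+1) (j%:R - x) / (x + j%:R) ^+ 3).
Proof.
move=> x0.
have d1 (j : nat) : is_derive x 1 (fun y => (y + j%:R)^-1) (- (x + j%:R)^-2).
  by apply: is_derive_inv_shift; exact: addr_natr_gt0.
have d2 (j : nat) : is_derive x 1 (fun y => (y + j%:R)^-2)
    (- 2 * (x + j%:R)^-3).
  have dM := is_deriveM (d1 j) (d1 j); move: dM.
  rewrite (_ : (fun y : R => _) * _ = (fun y => (y + j%:R)^-2)).
    move=> dM; apply: (is_derive_eq dM); rewrite /GRing.scale/=.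
    by field; rewrite gt_eqF// addr_natr_gt0.
  by apply/funext => y /=; rewrite -[LHS]/(_ * _) expr2 invfM.
have dS : is_derive x 1 (fun y => \sum_(j < N.+1) (y + j%:R)^-2)
   (\sum_(j < N.+1) - 2 * (x + j%:R)^-3) by exact: is_derive_bigsum.
have dM := is_deriveM (is_derive_id x 1) (is_deriveD (d1 N.+1) dS).
apply: (is_derive_eq dM); rewrite /GRing.scale/= !mulr1 -[_ _ x]/(_ + _).
move: (addr_natr_gt0 N.+1 x0); move: (N.+1%:R : R) => n xn.
rewrite mulrDr addrACA; congr (_ + _).
  by field; rewrite gt_eqF.
rewrite mulr_sumr -big_split/=; apply: eq_bigr => j _.
by field; rewrite gt_eqF// addr_natr_gt0.
Qed.

(** The bound is uniform in N, so that strictness survives the limit. *)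
Lemma log_derivative_decreasing N x y c : 0 < x -> x < y -> y <= c ->
  y * digamma_approx_der N.+1 y - x * digamma_approx_der N.+1 x <=
    - (y - x) / (c ^+ 2 * (c + 1)).
Proof.
move=> x0 xy yc.
have [|z] := MVT xy (fun z zxy => is_derive_log_derivative N
    (lt_trans x0 (proj1 (andP zxy)) : 0 < z)).
  apply: derivable_within_continuous => z; rewrite in_itv/= => /andP[xz _].
  by have [] := is_derive_log_derivative N (lt_le_trans x0 xz).
rewrite in_itv/= => /andP[xz zy] ->.
have z0 : 0 < z by lra.
rewrite mulNr -mulrN mulrC ler_wpM2l ?subr_ge0 ?(ltW xy)//.
apply: (@le_trans _ _ (- (z ^+ 2 * (z + 1))^-1)).
  apply: le_trans (log_concavity_bound N z0); rewrite addrC lerD2l.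
  have zN := addr_natr_gt0 N z0; have zN1 := addr_natr_gt0 N.+1 z0.
  rewrite ler_wpM2l// lef_pV2 ?posrE ?mulr_gt0 ?exprn_gt0//.
  by rewrite expr2 ler_wpM2r ?(ltW zN1)// lerD2l ler_nat.
have c0 : 0 < c by lra.
rewrite lerN2 lef_pV2 ?posrE ?mulr_gt0 ?exprn_gt0//; try lra.
by rewrite ler_pM ?exprn_ge0 ?lerXn2r ?nnegrE//; lra.
Qed.

(** The derivative of x |-> psi_N(x) - psi_N((1 - t) x), multiplied by x, is the
difference of y * psi_N'(y) between x and (1 - t) x, so the mean value theorem
reduces the claim to [log_derivative_decreasing]. *)
Lemma digamma_approx_log_concave N a c t : 0 < a -> a < c -> 0 < t < 1 ->
  t * (c - a) / (c ^+ 2 * (c + 1)) <=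
    (digamma_approx N.+1 a - digamma_approx N.+1 ((1 - t) * a)) -
    (digamma_approx N.+1 c - digamma_approx N.+1 ((1 - t) * c)).
Proof.
move=> a0 ac t01.
have l0 : 0 < 1 - t by lra.
pose G x := digamma_approx N.+1 x - digamma_approx N.+1 ((1 - t) * x).
pose dG x := digamma_approx_der N.+1 x -
   digamma_approx_der N.+1 ((1 - t) * x) * (1 - t).
have GD x : 0 < x -> is_derive x 1 G (dG x).
  move=> x0; apply: is_deriveB; first exact: is_derive_digamma_approx.
  apply: (@is_derive1_comp R (digamma_approx N.+1) (fun y => (1 - t) * y)).
    by apply: is_derive_digamma_approx; rewrite mulr_gt0.
  by apply: is_derive_eq; rewrite /GRing.scale/= mulr1.
have [|z] := MVT ac (fun z zac => GD z (lt_trans a0 (proj1 (andP zac)) : 0 < z)).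
  apply: derivable_within_continuous => z; rewrite in_itv/= => /andP[xz _].
  by have [] := GD z (lt_le_trans a0 xz).
rewrite in_itv/= => /andP[az zc] GE.
have z0 : 0 < z by lra.
have tz : (1 - t) * z < z by rewrite gtr_pMl//; lra.
have := log_derivative_decreasing N (mulr_gt0 l0 z0) tz (ltW zc).
have -> : z * digamma_approx_der N.+1 z -
    (1 - t) * z * digamma_approx_der N.+1 ((1 - t) * z) = z * dG z.
  by rewrite /dG; ring.
have -> : - (z - (1 - t) * z) / (c ^+ 2 * (c + 1)) =
    z * (- t / (c ^+ 2 * (c + 1))) by ring.
rewrite ler_pM2l// => dGz.
have := ler_wpM2r (_ : 0 <= c - a) dGz.
rewrite subr_ge0 -GE => /(_ (ltW ac)).
rewrite /G -lerN2 => H; apply: le_trans (le_trans H _).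
  by rewrite !mulNr opprK mulrAC.
lra.
Qed.

Lemma digamma_log_concave a c t : 0 < a -> a < c -> 0 <= t < 1 ->
  t * (c - a) / (c ^+ 2 * (c + 1)) <=
    (digamma a - digamma ((1 - t) * a)) - (digamma c - digamma ((1 - t) * c)).
Proof.
move=> a0 ac /andP[]; rewrite le_eqVlt => /predU1P[<- _|t0 t1].
  rewrite subr0 !mul1r; move: (digamma a) (digamma c) => u v.
  by rewrite !mul0r !subrr.
rewrite -lerN2.
have l0 : 0 < 1 - t by lra.
have c0 : 0 < c by lra.
apply: (@le_from_digamma_approx (fun N =>
    - ((digamma_approx N a - digamma_approx N ((1 - t) * a)) -
    (digamma_approx N c - digamma_approx N ((1 - t) * c))))).
  by apply: cvgN; apply: cvgB; apply: cvgB; apply: digamma_approx_to_digamma => //;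
     rewrite mulr_gt0.
by move=> N; rewrite lerN2; apply: digamma_approx_log_concave; rewrite ?t0.
Qed.

Lemma digamma_continuous x : 0 < x -> {for x, continuous (@digamma R)}.
Proof.
move=> x0; apply/cvgrPdist_le => e e0.
pose L := (x / 2)^-1 + (x / 2)^-2.
have L0 : 0 < L by rewrite addr_gt0 ?invr_gt0 ?exprn_gt0 ?divr_gt0.
have Lip u v : x / 2 <= u -> u <= v -> digamma v - digamma u <= (v - u) * L.
  move=> xu uv; have u0 : 0 < u by lra.
  apply: le_trans (digamma_lipschitz u0 uv) _.
  rewrite ler_wpM2l ?subr_ge0// lerD ?lef_pV2 ?posrE ?exprn_gt0 ?divr_gt0//.
  by rewrite lerXn2r ?nnegrE//; lra.
near=> z.
have zx : `|x - z| < x / 2 by near: z; apply: (@cvgr_dist_lt _ _ _ _ _ id x cvg_id); lra.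
have ze : `|x - z| <= e / L.
  by apply/ltW; near: z; apply: (@cvgr_dist_lt _ _ _ _ _ id x cvg_id); rewrite divr_gt0.
move: ze; rewrite ler_pdivlMr//; apply: le_trans.
have xz2 : x / 2 <= z by move: zx; rewrite ltr_norml; lra.
have z0 : 0 < z by lra.
have [zlex|/ltW xlez] := leP z x.
  have zlex0 : 0 <= x - z by lra.
  rewrite (ger0_norm zlex0) ger0_norm; first exact: Lip.
  by rewrite subr_ge0 digamma_mono.
have xlez0 : 0 <= z - x by lra.
rewrite distrC [X in _ <= X * _]distrC (ger0_norm xlez0) ger0_norm.
  by apply: Lip => //; lra.
by rewrite subr_ge0 digamma_mono.
Unshelve. all: by end_near. Qed.

Lemma IVT_increasing_ends (f : R -> R) (a b y : R) : a <= b ->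
  {within `[a, b], continuous f} -> f a <= y -> y <= f b ->
  exists2 x, x \in `[a, b] & f x = y.
Proof.
by move=> ab cf fa fb; apply: IVT => //; rewrite ge_min le_max fa fb orbT.
Qed.

(** Between exp y and exp(|y| + 1), by the bounds ln x - 1 / x <= psi(x) <= ln x. *)
Lemma digamma_surj y : exists2 x, 0 < x & digamma x = y.
Proof.
pose a := expR y; pose b := expR (`|y| + 1).
have a0 : 0 < a by exact: expR_gt0.
have b0 : 0 < b by exact: expR_gt0.
have ab : a <= b by rewrite ler_expR; have := ler_norm y; lra.
have fa : digamma a <= y by have /andP[_] := digamma_ln_bounds a0; rewrite expRK.
have fb : y <= digamma b.
  have /andP[+ _] := digamma_ln_bounds b0; rewrite expRK.
  apply: le_trans.
  have : b^-1 <= 1.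
    by rewrite invf_le1// -[leLHS]expR0 ler_expR; have := normr_ge0 y; lra.
  by have := ler_norm y; lra.
have cont : {within `[a, b], continuous (@digamma R)}.
  apply: continuous_in_subspaceT => x /set_mem/=; rewrite in_itv/= => /andP[ax _].
  by apply: digamma_continuous; exact: lt_le_trans ax.
have [x xab xy] := IVT_increasing_ends ab cont fa fb.
exists x => //; move: xab; rewrite in_itv/= => /andP[ax _].
exact: lt_le_trans ax.
Qed.

Lemma digammaK x : 0 < x -> digamma_inv (digamma x) = x.
Proof.
move=> x0; have pos z : z \in (`]0, +oo[%classic : set R) -> 0 < z.
  by move=> /set_mem/=; rewrite in_itv/= andbT.
apply: pinvKV; last by apply/mem_set; rewrite /= in_itv/= andbT.
move=> u v /pos u0 /pos v0 uv; apply/eqP.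
by rewrite eq_le -(digamma_mono u0 v0) -(digamma_mono v0 u0) uv lexx.
Qed.

Lemma digamma_inv_gt0 y : 0 < digamma_inv y.
Proof. by have [x x0 <-] := digamma_surj y; rewrite digammaK. Qed.

Lemma digamma_invK y : digamma (digamma_inv y) = y.
Proof. by have [x x0 <-] := digamma_surj y; rewrite digammaK. Qed.
End digamma_estimates.

(** * Contraction along the ray through the fixed point *)

(** Log-concavity leaves a gap proportional to t between the two decrements; the
Lipschitz bound shows that replacing t by q t on the side of a costs at most
a multiple (1 - q) of t, which the gap absorbs for q close to 1. *)
Lemma digamma_contraction {R : realType} (a c t0 : R) :
  0 < a -> a < c -> 0 <= t0 < 1 ->
  \forall q \near 1^'-, forall t, 0 <= t <= t0 ->
    digamma c - digamma ((1 - t) * c) <= digamma a - digamma ((1 - q * t) * a).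
Proof.
move=> a0 ac /andP[t00 t01].
pose m := (1 - t0) * a; pose L := a * (m^-1 + m^-2).
have m0 : 0 < m by rewrite mulr_gt0// subr_gt0.
have L0 : 0 < L by rewrite mulr_gt0// addr_gt0 ?invr_gt0 ?exprn_gt0.
have c0 : 0 < c by exact: lt_trans ac.
pose k := (c - a) / (c ^+ 2 * (c + 1)).
have k0 : 0 < k.
  by rewrite divr_gt0 ?subr_gt0// mulr_gt0 ?exprn_gt0// addr_gt0.
near=> q.
have q1 : q < 1 by near: q; exact: nbhs_left_lt.
have q0 : 0 < q by near: q; exact: nbhs_left_gt.
have qk : (1 - q) * L <= k.
  rewrite -ler_pdivlMr// lerBlDr -lerBlDl; near: q.
  by apply: nbhs_left_ge; rewrite gtrBl divr_gt0.
move=> t /andP[t_ge0 tt0].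
have t1 : t < 1 by exact: le_lt_trans t01.
have x0 : 0 < (1 - t) * a by rewrite mulr_gt0// subr_gt0.
have mx : m <= (1 - t) * a by rewrite ler_wpM2r ?(ltW a0)// lerD2l lerN2.
have xy : (1 - t) * a <= (1 - q * t) * a.
  by rewrite ler_wpM2r ?(ltW a0)// lerD2l lerN2 ler_piMl// ltW.
have Lip : digamma ((1 - q * t) * a) - digamma ((1 - t) * a) <= t * k.
  apply: le_trans (digamma_lipschitz x0 xy) _.
  apply: (@le_trans _ _ (t * ((1 - q) * L))); last by rewrite ler_wpM2l.
  have -> : (1 - q * t) * a - (1 - t) * a = t * (1 - q) * a by ring.
  rewrite /L !mulrA ler_wpM2l//.
    by rewrite !mulr_ge0 ?subr_ge0// ltW.
  by rewrite lerD// lef_pV2 ?posrE ?exprn_gt0// lerXn2r// nnegrE ltW.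
have := @digamma_log_concave R a c t a0 ac (introT andP (conj t_ge0 t1)).
rewrite -mulrA -/k; move: Lip; clear.
move: (digamma a) (digamma c) (digamma ((1 - t) * a)) => u v w.
move: (digamma _) (digamma _) => x y; lra.
Unshelve. all: by end_near. Qed.

(** Log-concavity for the ratio 1/2. *)
Lemma digamma_double_decreasing {R : realType} (x y : R) : 0 < x -> 0 < y ->
  digamma (2 * y) - digamma y <= digamma (2 * x) - digamma x -> x <= y.
Proof.
move=> x0 y0 H; rewrite leNgt; apply/negP => yx; move: H; apply/negP.
rewrite -ltNge.
have half (z : R) : (1 - 2^-1) * (2 * z) = z by field.
have y20 : 0 < 2 * y by rewrite mulr_gt0.
have yx2 : 2 * y < 2 * x by rewrite ltr_pM2l.
have t12 : 0 <= (2^-1 : R) < 1 by rewrite invr_ge0 ler0n/= invf_lt1 ?ltr1n.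
have := digamma_log_concave y20 yx2 t12; rewrite !half => gap.
rewrite -subr_gt0; apply: lt_le_trans gap.
by rewrite divr_gt0 ?mulr_gt0 ?invr_gt0 ?subr_gt0 ?exprn_gt0 ?addr_gt0 ?mulr_gt0//.
Qed.

(** Beyond being an increasing bijection, psi enters only through the two
consequences [psi_double] and [psi_contr] of log-concavity. *)
Section fixed_point_iteration.
Context {R : realType} (psi psi_inv : R -> R).
Context (psi_mono : forall x y, 0 < x -> 0 < y -> (psi x <= psi y) = (x <= y))
  (psi_inv_gt0 : forall y, 0 < psi_inv y)
  (psi_invK : cancel psi_inv psi)
  (psi_double : forall x y, 0 < x -> 0 < y ->
     psi (2 * y) - psi y <= psi (2 * x) - psi x -> x <= y)
  (psi_contr : forall a c t0 : R, 0 < a -> a < c -> 0 <= t0 < 1 ->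
     \forall q \near 1^'-, forall t, 0 <= t <= t0 ->
     psi c - psi ((1 - t) * c) <= psi a - psi ((1 - q * t) * a)).
(** Both blocks of unknowns are treated at once: the coordinate k is averaged
against the d coordinates in [nb k]. For the ML equations k ranges over the
concatenation of the two blocks and [nb k] lies in the block opposite to k. *)
Context (m d : nat) (nb : 'I_m -> {set 'I_m}) (r : 'I_m -> R).
Context (d0 : (0 < d)%N) (card_nb : forall k, #|nb k| = d).
Implicit Types theta eta : 'rV[R]_m.

Definition mean_map theta : 'rV[R]_m :=
  \row_k psi_inv (r k + d%:R^-1 * \sum_(l in nb k) psi (theta 0 k + theta 0 l)).

Lemma le_mean k (f : 'I_m -> R) b : (forall l, l \in nb k -> b <= f l) ->
  b <= d%:R^-1 * \sum_(l in nb k) f l.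
Proof.
move=> bf; rewrite ler_pdivlMl ?ltr0n// mulr_natl -(card_nb k) -sumr_const.
exact: ler_sum.
Qed.

Lemma psi_mean_map theta k : psi (mean_map theta 0 k) =
  r k + d%:R^-1 * \sum_(l in nb k) psi (theta 0 k + theta 0 l).
Proof. by rewrite mxE psi_invK. Qed.

Lemma mean_map_gt0 theta k : 0 < mean_map theta 0 k.
Proof. by rewrite mxE. Qed.

Lemma mean_map_homo theta eta :
  (forall k, 0 < theta 0 k) -> (forall k, theta 0 k <= eta 0 k) ->
  forall k, mean_map theta 0 k <= mean_map eta 0 k.
Proof.
move=> t0 te k; have e0 l : 0 < eta 0 l by exact: lt_le_trans (te l).
rewrite -psi_mono ?mean_map_gt0// !psi_mean_map lerD2l ler_wpM2l ?invr_ge0//.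
by apply: ler_sum => l _; rewrite psi_mono ?addr_gt0// lerD.
Qed.

Context (hat : 'rV[R]_m).
Context (hat_gt0 : forall k, 0 < hat 0 k) (hat_fix : mean_map hat = hat).

(** At a smallest coordinate mu of the fixed point all arguments of psi in the mean
are at least 2 mu. *)
Lemma start_le_fixpoint eps : 0 < eps ->
  (forall k, - r k <= psi (2 * eps) - psi eps) -> forall k, eps <= hat 0 k.
Proof.
move=> eps0 rM k.
case: (@arg_minP _ _ _ k predT (fun l => hat 0 l) isT) => k0 _ kmin.
apply: le_trans (kmin k isT); apply: psi_double => //.
apply: le_trans (rM k0); rewrite lerBlDr addrC -lerBlDr opprK.
rewrite -[in leRHS]hat_fix psi_mean_map addrC lerD2l.
apply: le_mean => l _; rewrite psi_mono ?addr_gt0 ?mulr_gt0//.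
by rewrite mulr_natl mulr2n lerD2l kmin.
Qed.

(** A common q exists since only finitely many pairs of coordinates occur, each
admitting all q close enough to 1. *)
Lemma mean_map_contraction t0 : 0 <= t0 < 1 -> exists2 q, 0 < q < 1 &
  forall t theta, 0 <= t <= t0 -> (forall k, (1 - t) * hat 0 k <= theta 0 k) ->
  forall k, (1 - q * t) * hat 0 k <= mean_map theta 0 k.
Proof.
move=> t01; have /andP[t00 t0lt1] := t01.
have contr : \forall q \near 1^'-, 0 < q < 1 /\ forall k l t, 0 <= t <= t0 ->
    psi (hat 0 k + hat 0 l) - psi ((1 - t) * (hat 0 k + hat 0 l)) <=
    psi (hat 0 k) - psi ((1 - q * t) * hat 0 k).
  near=> q; split.
    apply/andP; split; near: q; [exact: nbhs_left_gt|exact: nbhs_left_lt].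
  near: q; apply: filter_forall => k; apply: filter_forall => l.
  by apply: psi_contr => //; rewrite ltrDl.
have [q [q01 qP]] := filter_ex contr.
exists q => // t theta tt0 lower k.
have /andP[t_ge0 t_le] := tt0; have /andP[q0 q1] := q01.
have t1 : 0 < 1 - t by lra.
have qt : 0 < 1 - q * t.
  by rewrite subr_gt0 (le_lt_trans _ t0lt1)// (le_trans _ t_le)// ler_piMl// ltW.
have theta0 l : 0 < theta 0 l by apply: lt_le_trans (lower l); rewrite mulr_gt0.
rewrite -psi_mono ?mean_map_gt0 ?mulr_gt0//.
have -> : psi ((1 - q * t) * hat 0 k) = r k + d%:R^-1 * \sum_(l in nb k)
    (psi (hat 0 k + hat 0 l) - (psi (hat 0 k) - psi ((1 - q * t) * hat 0 k))).
  rewrite sumrB mulrBr addrA -psi_mean_map hat_fix sumr_const card_nb.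
  rewrite mulrnAr -mulrnAl -[_^-1 *+ d]mulr_natl mulfV ?pnatr_eq0 -?lt0n//.
  by rewrite mul1r subKr.
rewrite psi_mean_map lerD2l ler_wpM2l ?invr_ge0//; apply: ler_sum => l _.
have c0 : 0 < hat 0 k + hat 0 l by rewrite addr_gt0.
have le_theta : psi ((1 - t) * (hat 0 k + hat 0 l)) <= psi (theta 0 k + theta 0 l).
  rewrite psi_mono; [|by rewrite mulr_gt0|by rewrite addr_gt0].
  by rewrite mulrDr; apply: lerD; exact: lower.
by have := qP k l t tt0; lra.
Unshelve. all: by end_near. Qed.

Lemma cvg_mean_map eps : 0 < eps ->
  (forall k, - r k <= psi (2 * eps) - psi eps) ->
  cvg_geometrically (fun it => iter it mean_map (const_mx eps)) hat.
Proof.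
move=> eps0 rM.
pose B := eps + \sum_k hat 0 k.
have hatB k : hat 0 k <= B.
  rewrite /B (bigD1 k)//= addrCA lerDl addr_ge0 ?(ltW eps0)//.
  by apply: sumr_ge0 => l _; exact: ltW.
have B0 : 0 < B by rewrite ltr_wpDr// sumr_ge0// => l _; exact: ltW.
have epsB : eps <= B by rewrite lerDl sumr_ge0// => l _; exact: ltW.
(* as hat <= B, the ray point (1 - t0) * hat lies below the starting point *)
pose t0 := 1 - eps / B.
have t01 : 0 <= t0 < 1.
  by rewrite subr_ge0 ler_pdivrMr// mul1r epsB/= gtrBl divr_gt0.
have [q q01 qP] := mean_map_contraction t01.
have /andP[q0 q1] := q01; have /andP[t00 t0lt1] := t01.
have qn it : 0 <= q ^+ it * t0 <= t0.
  by rewrite mulr_ge0 ?exprn_ge0 ?(ltW q0)//= ler_piMl// exprn_ile1// ltW.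
have bounds it k : let u := iter it mean_map (const_mx eps) in
    0 < u 0 k /\ (1 - q ^+ it * t0) * hat 0 k <= u 0 k <= hat 0 k.
  elim: it k => [|it ih] k /=.
    rewrite mxE expr0 mul1r subKr start_le_fixpoint// andbT; split => //.
    by rewrite mulrAC ler_pdivrMr// ler_pM2l.
  split; first exact: mean_map_gt0.
  apply/andP; split.
    by rewrite exprS -mulrA; apply: qP => // l; have [_ /andP[]] := ih l.
  rewrite -[in leRHS]hat_fix; apply: mean_map_homo => l.
    by have [] := ih l.
  by have [_ /andP[]] := ih l.
exists B, q; split => // it.
have Bq0 : 0 <= B * q ^+ it by rewrite mulr_ge0 ?exprn_ge0// ltW.
rewrite /Num.Def.normr/= mx_normrE; apply: bigmax_le => //= -[i k] _ /=.
rewrite ord1 !mxE distrC.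
have [_ /andP[lo up]] := bounds it k.
rewrite ger0_norm ?subr_ge0// lerBlDl -lerBlDr.
apply: le_trans lo; rewrite mulrBl mul1r lerD2l lerN2.
rewrite mulrC ler_pM// ?mulr_ge0 ?exprn_ge0 ?(ltW q0) ?(ltW (hat_gt0 _))//.
by rewrite ler_piMr ?exprn_ge0 ?(ltW q0)// ltW.
Qed.
End fixed_point_iteration.

(** * The maximum likelihood equations *)

Section ML_equations.
Context {R : realType} (n : nat) (W : 'M[R]_n).
Implicit Types theta : 'rV[R]_(n + n).

Definition opponents (k : 'I_(n + n)) : {set 'I_(n + n)} :=
  match fintype.split k with
  | inl i => [set rshift n j | j in predC1 i]
  | inr j => [set lshift n i | i in predC1 j]
  end.

Definition mean_log (k : 'I_(n + n)) : R :=
  match fintype.split k with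
  | inl i => rowlog W i / n.-1%:R
  | inr j => collog W j / n.-1%:R
  end.

Lemma card_opponents k : #|opponents k| = n.-1.
Proof.
rewrite /opponents; case: fintype.split => i; rewrite card_imset ?cardC1 ?card_ord//.
  exact: rshift_inj.
exact: lshift_inj.
Qed.

Lemma ML_map_mean_map : ML_map W = mean_map digamma digamma_inv n.-1 opponents mean_log.
Proof.
apply/funext => theta; apply/rowP => k; rewrite [RHS]mxE /opponents /mean_log.
case: (split_ordP k) => i ->.
  rewrite row_mxEl mxE big_imset/=; last first.
    by move=> ? ? _ _; exact: rshift_inj.
  rewrite mulrC; congr (digamma_inv (_ + _ * _)).
  by apply: eq_big => j; rewrite ?inE// !mxE.
rewrite row_mxEr mxE big_imset/=; last first.
  by move=> ? ? _ _; exact: lshift_inj.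
rewrite mulrC; congr (digamma_inv (_ + _ * _)).
by apply: eq_big => j; rewrite ?inE// !mxE addrC.
Qed.

Lemma ML_solution_fixpoint theta : (2 <= n)%N ->
  ML_solution W theta -> ML_map W theta = theta.
Proof.
move=> n2 [theta0 rows cols].
have d0 : n.-1%:R != 0 :> R by rewrite pnatr_eq0 -lt0n; lia.
have solve (s p r : R) : s - n.-1%:R * p + r = 0 ->
    n.-1%:R^-1 * r + n.-1%:R^-1 * s = p.
  move=> e; rewrite -mulrDr; apply: (mulfI d0); rewrite mulVKf//; lra.
apply/rowP => k; case: (split_ordP k) => i ->.
  rewrite row_mxEl mxE (solve _ _ _ (rows i)) mxE.
  by apply: digammaK; exact: theta0.
rewrite row_mxEr mxE (solve _ _ _ (cols i)) mxE.
by apply: digammaK; exact: theta0.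
Qed.

Lemma mean_log_ge_ML_max k : - mean_log k <= ML_max W.
Proof.
rewrite /mean_log /ML_max le_max; case: fintype.split => i; apply/orP; [left|right];
  exact: (le_bigmax_cond _ (fun i => - (_ / _))).
Qed.

End ML_equations.
Unset Implicit Arguments.

Theorem theorem3 (R : realType) (n : nat) (W : 'M[R]_n)
    (theta_hat : 'rV[R]_(n + n)) (eps : R) :
  (2 <= n)%N ->
  (forall i, W i i = 0) ->
  (forall i j, i != j -> 0 < W i j < 1) ->
  unique (ML_solution W) theta_hat ->
  0 < eps ->
  digamma (2 * eps) - digamma eps = ML_max W ->
  cvg_geometrically (fun it => iter it (ML_map W) (const_mx eps)) theta_hat.
Proof.
move=> n2 _ _ [sol _] eps0 epsM.
have fixed := ML_solution_fixpoint n2 sol.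
have [hat0 _ _] := sol.
rewrite ML_map_mean_map in fixed *.
apply: (cvg_mean_map _ _ _ _ _ _ _ hat0 fixed eps0).
- exact: digamma_mono.
- exact: digamma_inv_gt0.
- exact: digamma_invK.
- exact: digamma_double_decreasing.
- exact: digamma_contraction.
- by lia.
- exact: card_opponents.
- by move=> k; rewrite epsM; exact: mean_log_ge_ML_max.
Qed.
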